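(* There exists a polynomial time algorithm that, given a non-negative DR-submodular function $F\colon[0,1]^{\mathcal N}\to\mathbb R_{\ge0}$ and a parameter $\varepsilon\in(0,1)$, accesses $F$ at $O(n\log(n\varepsilon^{-1}))$ points, where $n=|\mathcal N|$, and then outputs a vector $\mathbf x\in[0,1]^{\mathcal N}$ such that, for every fixed vector $\mathbf o\in[0,1]^{\mathcal N}$, \[F(\mathbf x)\ge\max_{r\ge0}\Big[\Big(\frac{2r}{(r+1)^2}-O(\varepsilon)\Big)F(\mathbf o)+\frac{1}{(r+1)^2}F(\mathbf 0)+\frac{r^2}{(r+1)^2}F(\mathbf 1)\Big].\]
   Context: $\mathcal N$ is a finite set and $F$ is accessed through a value oracle. $F$ is DR-submodular if $F(\mathbf x+z\mathbf 1_u)-F(\mathbf x)\ge F(\mathbf y+z\mathbf 1_u)-F(\mathbf y)$ for every $u\in\mathcal N$, every $\mathbf x\le\mathbf y$ (coordinate-wise) in $[0,1]^{\mathcal N}$ and $z\in[0,1-y_u]$; DR-submodular functions are assumed differentiable. $\mathbf 0,\mathbf 1$ are the all-zeros and all-ones vectors. The $O(\varepsilon)$ term hides an absolute constant. *)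

(* Defs.v *)
From HB Require Import structures.
From mathcomp Require Export all_boot all_order all_algebra.
From mathcomp Require Export all_classical all_reals all_analysis.
Export Order.TTheory GRing.Theory Num.Theory numFieldNormedType.Exports.

Set Implicit Arguments.
Unset Strict Implicit.
Unset Printing Implicit Defensive.

Local Open Scope classical_set_scope.
Local Open Scope ring_scope.

(* The ground set is enumerated as 'I_n, and a function on [0,1]^n is a total
   function on row vectors about which nothing is assumed outside the cube. *)

Definition unit_cube (R : realType) (n : nat) : set 'rV[R]_n :=
  [set x | forall u, 0 <= x 0 u <= 1].

Definition vle (R : realType) (n : nat) (x y : 'rV[R]_n) : Prop :=
  forall u, x 0 u <= y 0 u.

(* Differentiability is relative to the cube, hence one-sided on its boundary.
   [delta_mx 0 u] is the characteristic vector of u. *)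
Record dr_submodular (R : realType) (n : nat) (F : 'rV[R]_n -> R) : Prop := {
  dr_differentiable : forall x, unit_cube x ->
    differentiable F (within (@unit_cube R n) (nbhs x));
  dr_diminishing : forall (u : 'I_n) (x y : 'rV[R]_n) (z : R),
    unit_cube x -> unit_cube y -> vle x y -> 0 <= z <= 1 - y 0 u ->
    F (y + z *: delta_mx 0 u) - F y <= F (x + z *: delta_mx 0 u) - F x
}.

(* Algorithms are while programs for a real RAM (unit-cost exact arithmetic and
   comparisons, no rounding operation) with a value oracle. The memory consists
   of natural-number registers, used for counters and indirect addresses, and
   an array of real cells. A program is a finite syntactic object: it depends
   neither on n, nor on the precision, nor on the oracle, and its only real
   constants are natural numbers. *)

Inductive nexp : Type :=
| NConst of nat
| NReg of nat
| NAdd of nexp & nexp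
| NSub of nexp & nexp.

Inductive rexp : Type :=
| RNat of nexp
| RCell of nexp
| RAdd of rexp & rexp
| RSub of rexp & rexp
| RMul of rexp & rexp
| RDiv of rexp & rexp.

Inductive bexp : Type :=
| BNle of nexp & nexp
| BRle of rexp & rexp
| BNot of bexp
| BAnd of bexp & bexp.

Inductive cmd : Type :=
| Skip
| NAssign of nat & nexp
| RAssign of nexp & rexp
| Query of nexp & nexp
| Seq of cmd & cmd
| If of bexp & cmd & cmd
| While of bexp & cmd.

Record state (R : realType) : Type := State {
  nreg : nat -> nat;
  cell : nat -> R
}.

Fixpoint neval (R : realType) (s : state R) (e : nexp) : nat :=
  match e with
  | NConst k => k
  | NReg i => nreg s i
  | NAdd e1 e2 => neval s e1 + neval s e2
  | NSub e1 e2 => neval s e1 - neval s e2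
  end%N.

(* [RNat] converts a natural number to a real; division by 0 yields 0. *)
Fixpoint reval (R : realType) (s : state R) (e : rexp) : R :=
  match e with
  | RNat a => (neval s a)%:R
  | RCell a => cell s (neval s a)
  | RAdd e1 e2 => reval s e1 + reval s e2
  | RSub e1 e2 => reval s e1 - reval s e2
  | RMul e1 e2 => reval s e1 * reval s e2
  | RDiv e1 e2 => reval s e1 / reval s e2
  end.

Fixpoint beval (R : realType) (s : state R) (b : bexp) : bool :=
  match b with
  | BNle e1 e2 => (neval s e1 <= neval s e2)%N
  | BRle e1 e2 => reval s e1 <= reval s e2
  | BNot b1 => ~~ beval s b1
  | BAnd b1 b2 => beval s b1 && beval s b2
  end.

Definition set_nreg (R : realType) (s : state R) (i k : nat) : state R :=
  State [eta nreg s with i |-> k] (cell s).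

Definition set_cell (R : realType) (s : state R) (i : nat) (v : R) : state R :=
  State (nreg s) [eta cell s with i |-> v].

(* The vector stored in the n consecutive cells starting at [a]. *)
Definition read_vec (R : realType) (n : nat) (s : state R) (a : nat) :
    'rV[R]_n :=
  \row_(i < n) cell s (a + i)%N.

(* [exec F c s s' t q]: from s, the command c terminates in s' after t steps,
   q of which are oracle queries. [Query d a] stores in cell d the value of F at
   the vector read at address a; it is stuck unless this vector is in the cube,
   so a terminating run only accesses F on its domain. The expressions of a
   program have constant size, so evaluating one counts as a single step. *)
Inductive exec (R : realType) (n : nat) (F : 'rV[R]_n -> R) :
    cmd -> state R -> state R -> nat -> nat -> Prop :=
| exec_skip s :
    exec F Skip s s 1 0
| exec_nassign s i e :
    exec F (NAssign i e) s (set_nreg s i (neval s e)) 1 0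
| exec_rassign s a e :
    exec F (RAssign a e) s (set_cell s (neval s a) (reval s e)) 1 0
| exec_query s d a :
    unit_cube (read_vec n s (neval s a)) ->
    exec F (Query d a) s
      (set_cell s (neval s d) (F (read_vec n s (neval s a)))) 1 1
| exec_seq c1 c2 s s1 s2 t1 t2 q1 q2 :
    exec F c1 s s1 t1 q1 -> exec F c2 s1 s2 t2 q2 ->
    exec F (Seq c1 c2) s s2 (t1 + t2)%N (q1 + q2)%N
| exec_if_true b c1 c2 s s' t q :
    beval s b -> exec F c1 s s' t q ->
    exec F (If b c1 c2) s s' t.+1 q
| exec_if_false b c1 c2 s s' t q :
    ~~ beval s b -> exec F c2 s s' t q ->
    exec F (If b c1 c2) s s' t.+1 q
| exec_while_true b c s s1 s2 t1 t2 q1 q2 :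
    beval s b -> exec F c s s1 t1 q1 -> exec F (While b c) s1 s2 t2 q2 ->
    exec F (While b c) s s2 (t1 + t2).+1 (q1 + q2)%N
| exec_while_false b c s :
    ~~ beval s b ->
    exec F (While b c) s s 1 0.

(* The input n is in register 0 and the input eps in cell 0; all other registers
   and cells are 0. The output vector is read in cells 0, ..., n - 1. *)
Definition init_state (R : realType) (n : nat) (eps : R) : state R :=
  State [eta (fun=> 0%N) with 0%N |-> n] [eta (fun=> 0) with 0%N |-> eps].

Definition output (R : realType) (n : nat) (s : state R) : 'rV[R]_n :=
  read_vec n s 0.

(* Main.v *)
Require Import Defs.
From mathcomp Require Import zify ring lra.
Local Open Scope classical_set_scope.
Local Open Scope ring_scope.

Set Implicit Arguments.
Unset Strict Implicit.
Unset Printing Implicit Defensive.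

(* Double greedy on a grid. Process the coordinates one by one, keeping a lower
   vector x and an upper vector y that agree on the processed coordinates and are
   0 and 1 on the others. Along the current coordinate put
   g(z) = F(x with z) and h(z) = F(y with z); both are concave and g' >= h'. At a
   zero z of g'(z) (1 - z) + h'(z) z, the gains A = g(z) - g(0) and
   B = h(z) - h(1) and the loss L of an arbitrary o lying between x and y, when
   its coordinate is replaced by z, satisfy L ^ 2 <= A B, hence
   A + r ^ 2 B >= 2 r L for every r >= 0 at once. Summing over the coordinates
   gives (r + 1) ^ 2 F(x) >= 2 r F(o) + F(0) + r ^ 2 F(1).

   Derivatives are replaced by increments between neighbours in the grid
   {j / N}, and the sign change is located by binary search over the
   N + 1 = 2 ^ m grid points, which needs only monotone increments and no
   differentiability. With M = sup F, one coordinate costs an error 9 M / N, so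
   N > 18 n / eps suffices for a total error of order eps M. This error is
   relative to F(o): taking r = 1 and the supremum over o gives M <= 4 F(x), so
   M <= 4 F(o) unless F(o) < F(x), in which case the bound is immediate from
   F(x) >= F(0), F(1). *)

(** * Balanced points of concave sequences *)

(** One relation for both comparisons of slopes: with [h = g] it is concavity, and for two slices of
    F it says that g' at a point dominates h' at every later point. *)
Definition nonincr_incr (R : realType) (g h : R -> R) : Prop :=
  forall a b d, 0 <= a -> a <= b -> 0 <= d -> b + d <= 1 ->
    h (b + d) - h b <= g (a + d) - g a.

Lemma am_gm_weighted (R : realType) (a b l r : R) :
  0 <= a -> 0 <= b -> 0 <= l -> 0 <= r -> l ^+ 2 <= a * b ->
  2 * r * l <= a + r ^+ 2 * b.
Proof.
move=> a0 b0 l0 r0 lab.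
have rb0 : 0 <= r ^+ 2 * b by rewrite mulr_ge0 ?sqr_ge0.
(* Compare squares: 4 r^2 l^2 <= 4 r^2 a b <= (a + r^2 b)^2. *)
rewrite -(@ler_pXn2r _ 2%N) // ?nnegrE ?mulr_ge0 ?addr_ge0 //.
have : r ^+ 2 * l ^+ 2 <= r ^+ 2 * (a * b) by rewrite ler_wpM2l ?sqr_ge0.
have := sqr_ge0 (a - r ^+ 2 * b).
nra.
Qed.

Section Grid.
Variables (R : realType) (N : nat).

(** Telescoping with decreasing increments. The bound [al] is conditional because at [i = N] there
    is no increment to the right. *)
Lemma concave_seq_le (G : nat -> R) (i w : nat) (al : R) :
  (forall j k, (j <= k < N)%N -> G k.+1 - G k <= G j.+1 - G j) ->
  ((i < N)%N -> G i.+1 - G i <= al) -> (i <= w <= N)%N ->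
  G w - G i <= (w - i)%:R * al.
Proof.
move=> Gc Gi /andP[iw wN].
elim: w iw wN => [|w IH] iw wN.
  by move: iw; rewrite leqn0 => /eqP ->; rewrite subrr subnn mul0r.
move: iw; rewrite leq_eqVlt => /orP[/eqP <-|iw].
  by rewrite subrr subnn mul0r.
have := IH iw (ltnW wN).
have := Gc i w; rewrite -ltnS iw wN => /(_ isT).
have := Gi (leq_trans iw wN).
rewrite subSn // -natr1 mulrDl mul1r.
lra.
Qed.

Lemma concave_seq_ge (G : nat -> R) (i w : nat) (al : R) :
  (forall j k, (j <= k < N)%N -> G k.+1 - G k <= G j.+1 - G j) ->
  ((0 < i)%N -> al <= G i - G i.-1) -> (w <= i <= N)%N ->
  (i - w)%:R * al <= G i - G w.
Proof.
move=> Gc Gi /andP[wi iN].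
elim: i wi iN Gi => [|i IH] wi iN Gi.
  by move: wi; rewrite leqn0 => /eqP ->; rewrite subrr subnn mul0r.
move: wi; rewrite leq_eqVlt => /orP[/eqP <-|wi].
  by rewrite subrr subnn mul0r.
have /= Gi1 := Gi isT.
have : (i - w)%:R * al <= G i - G w.
  apply: IH (ltnW iN) _ => // i0; apply: le_trans Gi1 _.
  by have := Gc i.-1 i; rewrite prednK // leq_pred iN => /(_ isT).
rewrite subSn // -natr1 mulrDl mul1r.
lra.
Qed.

(* [g' (1 - z) + h' z] discretised on the cell [j, j + 1], whose position among
   the N cells is z = j / (N - 1); this makes its sign meaningful on both sides
   of a grid point. *)
Definition balance (G H : nat -> R) (j : nat) : R :=
  (G j.+1 - G j) * (N - j.+1)%:R + (H j.+1 - H j) * j%:R.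

(** [a], [c] and [a'], [c'] stand for the slopes of two sequences to the left and to the right of a
    grid point with [y + 1] cells before it and [x + 1] after it. On a path from the first balance
    to the second the sign changes; the slopes found there are [p] and [- q], those of supporting
    lines at the point. *)
Lemma balanced_slopes (a a' c c' x y : R) :
  a' <= a -> c' <= c -> c <= a -> c' <= a' -> 0 <= x -> 0 <= y ->
  0 <= a * (x + 1) + c * y -> a' * x + c' * (y + 1) <= 0 ->
  exists p q, [/\ a' <= p <= a, c' <= - q <= c,  0 <= p + q,
    y * q <= (x + 1) * p & x * p <= (y + 1) * q].
Proof.
move=> aa cc ca ca' x0 y0 H1 H2.
(* [f] combines the right slopes with the left weights. If it is nonnegative, the sign changes while
   the weights move and the right slopes serve; otherwise it changes while the slopes move, and [la]
   is the zero of their linear interpolation. *)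
pose f := a' * (x + 1) + c' * y.
case: (lerP 0 f) => f0.
  by exists a', (- c'); rewrite opprK !lexx aa cc; split=> //; rewrite /f in f0; lra.
pose e := a * (x + 1) + c * y.
have e0 : 0 <= e by [].
have ef : 0 < e - f by lra.
pose la := - f / (e - f).
have la0 : 0 <= la by rewrite divr_ge0 //; lra.
have la1 : la <= 1 by rewrite ler_pdivrMr //; lra.
have E : f + la * (e - f) = 0 by rewrite /la; field; lra.
exists (a' + la * (a - a')), (- (c' + la * (c - c'))).
have h1 : 0 <= la * (a - a') by rewrite mulr_ge0 // subr_ge0.
have h2 : la * (a - a') <= a - a' by rewrite ler_piMl // subr_ge0.
have h3 : 0 <= la * (c - c') by rewrite mulr_ge0 // subr_ge0.
have h4 : la * (c - c') <= c - c' by rewrite ler_piMl // subr_ge0.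
have h5 : 0 <= (1 - la) * (a' - c') by rewrite mulr_ge0 // subr_ge0.
have h6 : 0 <= la * (a - c) by rewrite mulr_ge0 // subr_ge0.
have E' : (a' + la * (a - a')) * (x + 1) + (c' + la * (c - c')) * y = 0.
  by rewrite -E /f /e; ring.
by split; [lra|lra|lra|lra|]; lra.
Qed.

(* The point i is chosen independently of the weight [r ^ 2] of the second
   gain: the product of the gains dominates the square of the loss. *)
Lemma balanced_gain (G H : nat -> R) (M : R) (i : nat) :
  (3 <= N)%N -> (i <= N)%N ->
  (forall j k, (j <= k < N)%N -> G k.+1 - G k <= G j.+1 - G j) ->
  (forall j k, (j <= k < N)%N -> H k.+1 - H k <= H j.+1 - H j) ->
  (forall j, (j < N)%N -> H j.+1 - H j <= G j.+1 - G j) ->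
  (forall j, (j <= N)%N -> 0 <= G j <= M) ->
  (forall j, (j <= N)%N -> 0 <= H j <= M) ->
  ((0 < i)%N -> 0 <= balance G H i.-1) ->
  ((i < N)%N -> balance G H i <= 0) ->
  exists l, [/\ G 0 <= G i, H N <= H i,
   forall r, 0 <= r -> 2 * r * l <= G i - G 0 + r ^+ 2 * (H i - H N),
   forall w, (i <= w <= N)%N -> G w - G i <= l + 6 * M / N%:R &
   forall w, (w <= i)%N -> H w - H i <= l + 6 * M / N%:R].
Proof.
move=> N3 iN Gc Hc HG GM HM bl br.
have M0 : 0 <= M by case/andP: (GM 0%N isT) => /le_trans h /h.
have NR : 3 <= N%:R :> R by rewrite (ler_nat R 3).
have e0 : 0 <= 6 * M / N%:R by rewrite divr_ge0 // ?mulr_ge0.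
(* At both ends [l = 0] works. At [i = 0] the first increment of [G] is nonpositive, so neither
   sequence ever increases; at [i = N] the last increment of [H] is nonnegative, so neither ever
   decreases. *)
case: (posnP i) => [i0|i_gt0].
  subst i; exists 0.
  have a0 : G 1%N - G 0 <= 0.
    have := br (leq_trans _ N3); rewrite /balance mulr0 addr0 => /(_ isT).
    by rewrite pmulr_lle0 // ltr0n subn_gt0 (leq_trans _ N3).
  have B0 : H N - H 0 <= 0.
    have := @concave_seq_le H 0 N 0 Hc; rewrite mulr0.
    apply; rewrite ?leqnn ?leq0n // => N0.
    by apply: le_trans a0; apply: HG.
  split=> //; first by lra.
  - move=> r r0; rewrite mulr0 subrr add0r mulr_ge0 ?sqr_ge0 //; lra.
  - move=> w w0; have := @concave_seq_le G 0 w 0 Gc (fun=> a0) w0.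
    by rewrite mulr0; lra.
  - by move=> w; rewrite leqn0 => /eqP ->; lra.
case: (ltngtP i N) (iN) => // [iltN _|iE _]; last first.
  subst i; exists 0.
  have c0 : 0 <= H N - H N.-1.
    have := bl i_gt0; rewrite /balance prednK // subnn mulr0 add0r.
    by rewrite pmulr_lge0 // ltr0n; lia.
  have a0 : 0 <= G N - G N.-1.
    by have := HG N.-1; rewrite prednK // leqnn => /(_ isT); lra.
  have A0 : 0 <= G N - G 0.
    by have := @concave_seq_ge G N 0 0 Gc (fun=> a0); rewrite mulr0 leqnn; apply.
  split=> //; first by lra.
  - by move=> r r0; rewrite subrr !mulr0 addr0.
  - by move=> w /andP[h1 h2]; have /eqP -> : w == N by [rewrite eqn_leq h2]; lra.
  - move=> w wN; have := @concave_seq_ge H N w 0 Hc (fun=> c0).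
    by rewrite wN leqnn mulr0 => /(_ isT); lra.
have {bl}bl := bl i_gt0; have {br}br := br iltN.
move: bl br; rewrite /balance prednK //.
set a := G i - G i.-1; set c := H i - H i.-1.
set a' := G i.+1 - G i; set c' := H i.+1 - H i.
set x : R := (N - i.+1)%:R; set y : R := i.-1%:R.
have -> : (N - i)%:R = x + 1 :> R by rewrite natr1 subnS prednK // subn_gt0.
have iR : i%:R = y + 1 :> R by rewrite natr1 prednK.
have NE : N%:R = x + y + 2 :> R.
  by rewrite -(natrD _ _ i.-1) -(natrD _ _ 2); congr (_%:R); lia.
rewrite iR => bl br.
have aa : a' <= a by have := Gc i.-1 i; rewrite prednK // leq_pred iltN => /(_ isT).
have cc : c' <= c by have := Hc i.-1 i; rewrite prednK // leq_pred iltN => /(_ isT).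
have ca : c <= a by have := HG i.-1; rewrite prednK //; apply.
have ca' : c' <= a' by apply: HG.
have x0 : 0 <= x by rewrite ler0n.
have y0 : 0 <= y by rewrite ler0n.
have [p [q [/andP[p1 p2] /andP[q1 q2] pq0 e1 e2]]] :=
  balanced_slopes aa cc ca ca' x0 y0 bl br.
have p0 : 0 <= p.
  rewrite leNgt; apply/negP => pn.
  have : 0 <= y * q by rewrite mulr_ge0 //; lra.
  have : (x + 1) * p < 0 by rewrite pmulr_rlt0 //; lra.
  lra.
have q0 : 0 <= q.
  rewrite leNgt; apply/negP => qn.
  have : 0 <= x * p by rewrite mulr_ge0 //; lra.
  have : (y + 1) * q < 0 by rewrite pmulr_rlt0 //; lra.
  lra.
have [xi yi] : (N - i)%:R = x + 1 :> R /\ (i - 0)%:R = y + 1 :> R.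
  by rewrite subn0 natr1 subnS prednK // subn_gt0.
have A1 : (y + 1) * p <= G i - G 0.
  by have := @concave_seq_ge G i 0 p Gc (fun=> p2); rewrite yi; apply; rewrite ltnW.
have B1 : H N - H i <= (x + 1) * - q.
  have := @concave_seq_le H i N (- q) Hc (fun=> q1); rewrite xi; apply.
  by rewrite ltnW //= leqnn.
have G1 w : (i <= w <= N)%N -> G w - G i <= (x + 1) * p.
  move=> /andP[h1 h2].
  apply: le_trans (@concave_seq_le G i w p Gc (fun=> p1) _) _; first by rewrite h1.
  by rewrite ler_wpM2r // -xi ler_nat leq_sub2r.
have H1 w : (w <= i)%N -> H w - H i <= (y + 1) * q.
  move=> h1; have := @concave_seq_ge H i w (- q) Hc (fun=> q2).
  rewrite h1 iN => /(_ isT).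
  have : (i - w)%:R * q <= (y + 1) * q by rewrite ler_wpM2r // -yi ler_nat leq_sub2l.
  lra.
have AM : (y + 1) * p <= M.
  by have := GM i iN; have := GM 0%N isT; lra.
have BM : (x + 1) * q <= M.
  by have := HM i iN; have := HM N (leqnn _); lra.
have yp0 : 0 <= y * p by rewrite mulr_ge0.
have xq0 : 0 <= x * q by rewrite mulr_ge0.
have xp0 : 0 <= x * p by rewrite mulr_ge0.
have yq0 : 0 <= y * q by rewrite mulr_ge0.
(* [AM] controls [p] well only if the left side is long, [BM] controls [q] only if the right side
   is. The balance inequality [e1] or [e2] carries the bound from the slope controlled on the longer
   side to the other one. By N >= 3 the larger of [x] and [y] is at least 1/2. *)
have [pM qM] : N%:R * p <= 6 * M /\ N%:R * q <= 6 * M.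
  have [xy|yx] := leP y x.
    have h1 : y * q <= x * q by rewrite ler_wpM2r.
    have h2 : y * p <= x * p by rewrite ler_wpM2r.
    have h3 : 0 <= (2 * x - 1) * p by rewrite mulr_ge0 //; lra.
    by rewrite NE; split; lra.
  have h1 : x * q <= y * q by rewrite ler_wpM2r // ltW.
  have h2 : x * p <= y * p by rewrite ler_wpM2r // ltW.
  have h3 : 0 <= (2 * y - 1) * q by rewrite mulr_ge0 //; lra.
  by rewrite NE; split; lra.
have pe : p <= 6 * M / N%:R by rewrite ler_pdivlMr; [rewrite mulrC|lra].
have qe : q <= 6 * M / N%:R by rewrite ler_pdivlMr; [rewrite mulrC|lra].
have pos (v w : R) : 0 <= v -> 0 <= w -> 0 <= (v + 1) * w.
  by move=> v0 w0; rewrite mulr_ge0 // addr_ge0.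
have A0 := pos y p y0 p0; have B0 := pos x q x0 q0.
have C0 := pos x p x0 p0; have D0 := pos y q y0 q0.
have CD : (x + 1) * p <= (y + 1) * q + 6 * M / N%:R.
  by rewrite (mulrDl x) mul1r lerD.
have DC : (y + 1) * q <= (x + 1) * p + 6 * M / N%:R.
  by rewrite (mulrDl y) mul1r lerD.
(* The two arguments bound the losses to the right and to the left and differ by at most 6 M / N.
   Their product regroups as ((y + 1) p) ((x + 1) q), which is at most the product of the two
   gains. *)
exists (Num.min ((x + 1) * p) ((y + 1) * q)); split.
- by rewrite -subr_ge0; apply: le_trans A1.
- by rewrite -subr_le0; apply: le_trans B1 _; rewrite mulrN oppr_le0.
- move=> r r0; apply: le_trans (_ : (y + 1) * p + r ^+ 2 * ((x + 1) * q) <= _).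
    apply: am_gm_weighted => //; first by rewrite le_min C0 D0.
    rewrite (_ : (y + 1) * p * _ = (x + 1) * p * ((y + 1) * q)); last by ring.
    by rewrite expr2; apply: ler_pM; rewrite ?le_min ?C0 ?D0 // ge_min lexx ?orbT.
  rewrite lerD // ler_wpM2l ?sqr_ge0 // -[leLHS]opprK lerNl opprB -mulrN.
  exact: B1.
- by move=> w /G1 h; rewrite addr_minl le_min (le_trans h) ?lerDl //= (le_trans h CD).
- by move=> w /H1 h; rewrite addr_minl le_min (le_trans h DC) (le_trans h) ?lerDl.
Qed.

End Grid.

(** * Rounding to the grid for a bounded concave function *)

Section Rounding.
Variables (R : realType) (N : nat) (g : R -> R) (M : R).
Hypotheses (N3 : (3 <= N)%N) (gc : nonincr_incr g g).
Hypothesis gM : forall z, 0 <= z <= 1 -> 0 <= g z <= M.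

(* m equal steps fit between the relevant point and the far end of [0, 1];
   their increments are monotone and add up to at most M. *)
Lemma increment_le (a d : R) (m : nat) :
  0 <= a -> 0 <= d -> a + m.+1%:R * d <= 1 ->
  g a - g (a + d) <= M / m.+1%:R.
Proof.
move=> a0 d0 ad.
have step k : (k <= m.+1)%N -> g (a + k%:R * d) - g a <= k%:R * (g (a + d) - g a).
  elim: k => [|k IH] km; first by rewrite !mul0r addr0 subrr.
  have := IH (ltnW km).
  have kd : 0 <= k%:R * d by rewrite mulr_ge0.
  have km' : a + k%:R * d + d <= 1.
    apply: le_trans ad; rewrite -addrA lerD2l -{2}(mul1r d) -mulrDl natr1.
    by rewrite ler_wpM2r // ler_nat.
  have := @gc a (a + k%:R * d) d a0; rewrite lerDl => /(_ kd d0 km').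
  by rewrite -natr1 !mulrDl !mul1r addrA; lra.
have := step _ (leqnn _).
have md0 : 0 <= m.+1%:R * d by rewrite mulr_ge0.
have := @gM a; have := @gM (a + m.+1%:R * d).
have -> : 0 <= a + m.+1%:R * d <= 1 by rewrite ad addr_ge0.
have -> : 0 <= a <= 1 by rewrite a0; lra.
move=> /(_ isT) h1 /(_ isT) h2 h3.
by rewrite ler_pdivlMr ?ltr0Sn // mulrC; lra.
Qed.

Lemma increment_ge (a d : R) (m : nat) :
  0 <= d -> m.+1%:R * d <= a -> a + d <= 1 ->
  g (a + d) - g a <= M / m.+1%:R.
Proof.
move=> d0 ma ad.
have step k : (k <= m.+1)%N -> k%:R * (g (a + d) - g a) <= g a - g (a - k%:R * d).
  elim: k => [|k IH] km; first by rewrite !mul0r subr0 subrr.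
  have := IH (ltnW km).
  have kd : 0 <= k%:R * d by rewrite mulr_ge0.
  have km' : k.+1%:R * d <= a.
    by apply: le_trans ma; rewrite ler_wpM2r // ler_nat.
  have h0 : 0 <= a - k.+1%:R * d by rewrite subr_ge0.
  have := @gc (a - k.+1%:R * d) a d h0.
  have -> : a - k.+1%:R * d + d = a - k%:R * d by rewrite -natr1; ring.
  have -> : a - k.+1%:R * d <= a by rewrite gerBl -natr1 mulrDl mul1r addr_ge0.
  move=> /(_ isT d0 ad).
  by rewrite -natr1 mulrDl mul1r; lra.
have := step _ (leqnn _).
have md0 : 0 <= m.+1%:R * d by rewrite mulr_ge0.
have := @gM a; have := @gM (a - m.+1%:R * d).
have -> : 0 <= a - m.+1%:R * d <= 1 by rewrite subr_ge0 ma; lra.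
have -> : 0 <= a <= 1 by lra.
move=> /(_ isT) h1 /(_ isT) h2 h3.
by rewrite ler_pdivlMr ?ltr0Sn // mulrC; lra.
Qed.

(** Rounding goes away from the nearer end of [0, 1]: up in the lower half, down in the upper half.
    About N / 2 further steps then fit before the far end, which limits the decrease of [g]. The
    last two clauses keep [v] on the same side of every grid point as [w]. *)
Lemma grid_rounding (w : R) : 0 <= w <= 1 ->
  exists v, [/\ (v <= N)%N, g w <= g (v%:R / N%:R) + 3 * M / N%:R,
    forall i, i%:R / N%:R <= w -> (i <= v)%N &
    forall i, (i <= N)%N -> w <= i%:R / N%:R -> (v <= i)%N].
Proof.
move=> /andP[w0 w1].
have NR : 3 <= N%:R :> R by rewrite (ler_nat R 3).
have N0 : 0 < N%:R :> R by lra.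
have M0 : 0 <= M.
  have : 0 <= g w <= M by apply: gM; rewrite w0.
  by case/andP => /le_trans h /h.
pose k := Num.truncn (w * N%:R).
have /andP[k1 k2] : k%:R <= w * N%:R < k.+1%:R.
  by apply: truncn_itv; rewrite mulr_ge0 // ltW.
(* The floor of N / 2 is at least N / 3, with equality at N = 3. *)
have m3 : M / (N./2)%:R <= 3 * M / N%:R.
  rewrite ler_pdivrMr; last by rewrite ltr0n half_gt0 ltnW.
  rewrite mulrAC ler_pdivlMr // [3 * M]mulrC -mulrA ler_wpM2l //.
  by rewrite -natrM ler_nat; lia.
have [mE m2] : N./2 = (N./2).-1.+1 /\ 2 * (N./2)%:R <= N%:R :> R.
  by split; [lia|rewrite -natrM ler_nat; lia].
have ge_i (i : nat) (z : R) : z * N%:R < i.+1%:R ->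
    forall j : nat, j%:R / N%:R <= z -> (j <= i)%N.
  move=> zi j; rewrite ler_pdivrMr // => jz.
  by rewrite -ltnS -(ltr_nat R); apply: le_lt_trans zi.
have [wh|wh] := lerP w (2^-1).
  (* A grid point must stay fixed, since moving it up would violate the last clause. *)
  have [kw|kw] := eqVneq (k%:R) (w * N%:R).
    have wE : w = k%:R / N%:R by rewrite kw mulfK // gt_eqF.
    exists k; split.
    - by rewrite -(ler_nat R) kw; nra.
    - by rewrite -wE lerDl divr_ge0 // ?mulr_ge0.
    - exact: ge_i.
    - by move=> i _; rewrite ler_pdivlMr // -kw ler_nat.
  have kw' : k%:R < w * N%:R by rewrite lt_neqAle kw.
  have kN : (k.+1 <= N)%N.
    by rewrite -(ltr_nat R); apply: lt_le_trans kw' _; nra.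
  exists k.+1; split=> //.
  - have := @increment_le w (k.+1%:R / N%:R - w) (N./2).-1 w0.
    rewrite -mE addrCA subrr addr0 subr_ge0 ler_pdivlMr // (ltW k2) => /(_ isT) h.
    suff : g w - g (k.+1%:R / N%:R) <= M / (N./2)%:R by lra.
    apply: h.
    have : k.+1%:R / N%:R - w <= N%:R^-1.
      rewrite -natr1 mulrDl mul1r.
      have : k%:R / N%:R <= w by rewrite ler_pdivrMr.
      lra.
    move=> /(ler_wpM2l (ler0n R (N./2))).
    have : (N./2)%:R / N%:R <= 2^-1 :> R by rewrite ler_pdivrMr //; lra.
    lra.
  - move=> i; rewrite ler_pdivrMr // => h; rewrite leqW // -ltnS -(ltr_nat R).
    exact: le_lt_trans k2.
  - move=> i _; rewrite ler_pdivlMr // => h; rewrite -(ltr_nat R).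
    exact: lt_le_trans h.
exists k; split.
- by rewrite -(ler_nat R); apply: le_trans k1 _; nra.
- have := @increment_ge (k%:R / N%:R) (w - k%:R / N%:R) (N./2).-1.
  rewrite -mE addrCA subrr addr0 subr_ge0 ler_pdivrMr // k1 => /(_ isT) h.
  suff : g w - g (k%:R / N%:R) <= M / (N./2)%:R by lra.
  apply: h => //.
  have d1 : w - k%:R / N%:R <= N%:R^-1.
    have : w < k.+1%:R / N%:R by rewrite ltr_pdivlMr.
    by rewrite -natr1 mulrDl mul1r; lra.
  apply: le_trans (_ : (N./2)%:R * N%:R^-1 <= _); first by rewrite ler_wpM2l.
  rewrite ler_wpM2r ?invr_ge0 ?(ltW N0) // ler_nat -ltnS -(ltr_nat R).
  apply: le_lt_trans k2; apply: le_trans (_ : 2^-1 * N%:R <= _); first by lra.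
  by rewrite ler_pM2r // ltW.
- exact: ge_i.
- by move=> i _; rewrite ler_pdivlMr // => h; rewrite -(ler_nat R); apply: le_trans h.
Qed.
End Rounding.

(** * Double greedy on the cube *)

Definition upd (R : realType) (n : nat) (x : 'rV[R]_n) (u : 'I_n) (z : R) : 'rV[R]_n :=
  \row_j (if j == u then z else x 0 j).

Section Vectors.
Variables (R : realType) (n : nat).
Implicit Types (x y o : 'rV[R]_n) (u : 'I_n) (z : R).

Lemma updE x u z j : upd x u z 0 j = if j == u then z else x 0 j.
Proof. by rewrite mxE. Qed.

Lemma upd_id x u : upd x u (x 0 u) = x.
Proof. by apply/rowP => j; rewrite updE; case: eqP => [->|]. Qed.

Lemma upd_upd x u z z' : upd (upd x u z) u z' = upd x u z'.
Proof. by apply/rowP => j; rewrite !updE; case: eqP. Qed.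

Lemma upd_cube x u z : unit_cube x -> 0 <= z <= 1 -> unit_cube (upd x u z).
Proof. by move=> hx hz j; rewrite updE; case: eqP. Qed.

Lemma upd_add x u z d : upd x u (z + d) = upd x u z + d *: delta_mx 0 u.
Proof.
by apply/rowP => j; rewrite !mxE eqxx; case: eqP; rewrite ?mulr1 ?mulr0 ?addr0.
Qed.

End Vectors.

Section DoubleGreedy.
Variables (R : realType) (n : nat) (F : 'rV[R]_n -> R).
Hypothesis F0 : forall x, unit_cube x -> 0 <= F x.
Hypothesis FDR : dr_submodular F.
Implicit Types (x y o : 'rV[R]_n) (u : 'I_n) (z : R).

Lemma nonincr_incr_upd x y u : unit_cube x -> unit_cube y -> vle x y ->
  nonincr_incr (fun z => F (upd x u z)) (fun z => F (upd y u z)).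
Proof.
move=> cx cy xy a b d a0 ab d0 bd.
rewrite !upd_add; apply: (dr_diminishing FDR).
- by apply: upd_cube => //; rewrite a0; lra.
- by apply: upd_cube => //; apply/andP; split; lra.
- by move=> j; rewrite !updE; case: eqP.
- by rewrite updE eqxx d0; lra.
Qed.

(** On a line parallel to an axis, 1/2 is the midpoint of w and 1 - w, so concavity and F >= 0 at 1
    - w give F(x) <= 2 F(x with 1/2). Doing this for each coordinate bounds F by 2^n times its value
    at the centre. *)
Lemma cube_bounded : exists B, forall x, unit_cube x -> F x <= B.
Proof.
pose mid k x : 'rV[R]_n := \row_j (if (j < k)%N then 2^-1 else x 0 j).
have midc k x : unit_cube x -> unit_cube (mid k x).
  by move=> cx j; rewrite mxE; case: ifP => // _; apply/andP; split; lra.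
have half x u : unit_cube x -> F x <= 2 * F (upd x u 2^-1).
  move=> cx; have h0 := nonincr_incr_upd u cx cx (fun j => lexx _).
  have /andP[w0 w1] := cx u.
  have opp : 0 <= F (upd x u (1 - x 0 u)).
    by apply: F0; apply: upd_cube => //; apply/andP; split; lra.
  rewrite -{1}(upd_id x u).
  have [w|w] := lerP (x 0 u) 2^-1.
    have := h0 (x 0 u) 2^-1 (2^-1 - x 0 u) w0 w.
    have -> : 2^-1 + (2^-1 - x 0 u) = 1 - x 0 u by lra.
    have -> : x 0 u + (2^-1 - x 0 u) = 2^-1 by lra.
    by rewrite subr_ge0 gerBl /= => /(_ w w0); lra.
  have := h0 (1 - x 0 u) 2^-1 (x 0 u - 2^-1).
  have -> : 1 - x 0 u + (x 0 u - 2^-1) = 2^-1 by lra.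
  have -> : 2^-1 + (x 0 u - 2^-1) = x 0 u by lra.
  rewrite /= !subr_ge0 w1 (ltW w) => /(_ isT).
  have -> : 1 - x 0 u <= 2^-1 by lra.
  by move=> /(_ isT isT isT); lra.
have step k x : (k <= n)%N -> unit_cube x -> F x <= 2 ^+ k * F (mid k x).
  elim: k => [|k IH] kn cx.
    rewrite expr0 mul1r; suff -> : mid 0%N x = x by [].
    by apply/rowP => j; rewrite mxE.
  apply: le_trans (IH (ltnW kn) cx) _.
  rewrite exprSr -mulrA ler_wpM2l ?exprn_ge0 //.
  have := half (mid k x) (Ordinal kn) (midc k x cx).
  suff -> : upd (mid k x) (Ordinal kn) 2^-1 = mid k.+1 x by [].
  apply/rowP => j; rewrite updE !mxE -val_eqE /= ltnS.
  by case: (ltngtP j k).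
exists (2 ^+ n * F (mid n 0)) => x cx.
have := step n x (leqnn _) cx.
suff -> : mid n x = mid n 0 by [].
by apply/rowP => j; rewrite !mxE ltn_ord.
Qed.

(** [M] occurs only in the analysis; its minimality later bounds it by a multiple of F at the
    output. *)
Lemma cube_sup : exists M, (forall x, unit_cube x -> F x <= M) /\
  (forall B, (forall x, unit_cube x -> F x <= B) -> M <= B).
Proof.
have [B FB] := cube_bounded.
have c0 : unit_cube (0 : 'rV[R]_n) by move=> j; rewrite mxE lexx ler01.
pose S := [set F x | x in @unit_cube R n].
have S0 : S !=set0 by exists (F 0), 0.
exists (sup S); split=> [x cx|C FC].
  apply: ub_le_sup; last by exists x.
  by exists B => _ [y cy <-]; apply: FB.
by apply: ge_sup => // _ [y cy <-]; apply: FC.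
Qed.

Variables (N : nat) (M : R).
Hypotheses (N3 : (3 <= N)%N) (FM : forall x, unit_cube x -> F x <= M).

Definition grid_slice x u (j : nat) : R := F (upd x u (j%:R / N%:R)).

Lemma grid_itv (j : nat) : (j <= N)%N -> 0 <= (j%:R / N%:R : R) <= 1.
Proof.
move=> jN; rewrite divr_ge0 //= ler_pdivrMr ?mul1r ?ler_nat //.
by rewrite ltr0n (leq_trans _ N3).
Qed.

Lemma grid_slice_incr x y u j k : unit_cube x -> unit_cube y -> vle x y ->
  (j <= k < N)%N ->
  grid_slice y u k.+1 - grid_slice y u k <= grid_slice x u j.+1 - grid_slice x u j.
Proof.
move=> cx cy xy /andP[jk kN]; rewrite /grid_slice.
have NR : 0 < N%:R :> R by rewrite ltr0n (leq_trans _ N3).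
have E (m : nat) : m.+1%:R / N%:R = m%:R / N%:R + N%:R^-1 :> R.
  by rewrite -natr1 mulrDl mul1r.
rewrite !E; apply: (nonincr_incr_upd _ cx cy xy).
- by rewrite divr_ge0.
- by rewrite ler_wpM2r ?invr_ge0 ?(ltW NR) // ler_nat.
- by rewrite invr_ge0 ltW.
- by rewrite -E; case/andP: (grid_itv kN).
Qed.

Lemma coordinate_step x y o u (i : nat) (z := i%:R / N%:R) :
  unit_cube x -> unit_cube y -> vle x o -> vle o y ->
  x 0 u = 0 -> y 0 u = 1 -> (i <= N)%N ->
  ((0 < i)%N -> 0 <= balance N (grid_slice x u) (grid_slice y u) i.-1) ->
  ((i < N)%N -> balance N (grid_slice x u) (grid_slice y u) i <= 0) ->
  [/\ F x <= F (upd x u z), F y <= F (upd y u z) &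
   forall r : R, 0 <= r ->
    2 * r * (F o - F (upd o u z) - 9 * M / N%:R) <=
    F (upd x u z) - F x + r ^+ 2 * (F (upd y u z) - F y)].
Proof.
move=> cx cy xo oy xu yu iN bl br.
have xy : vle x y by move=> j; apply: le_trans (xo j) (oy j).
have co : unit_cube o.
  by move=> j; have := cx j; have := cy j; have := xo j; have := oy j; lra.
have vr (v : 'rV[R]_n) : vle v v by move=> j.
have FMM v w : unit_cube v -> 0 <= w <= 1 -> 0 <= F (upd v u w) <= M.
  by move=> cv hw; rewrite F0 ?FM //; apply: upd_cube.
have NR : 0 < N%:R :> R by rewrite ltr0n (leq_trans _ N3).
have hz : 0 <= z <= 1 by apply: grid_itv.
have [l [A0 B0 gain lossG lossH]] := @balanced_gain R N _ _ M i N3 iN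
  (fun j k => grid_slice_incr u cx cx (vr x))
  (fun j k => grid_slice_incr u cy cy (vr y))
  (fun j jN => grid_slice_incr u cx cy xy (introT andP (conj (leqnn j) jN)))
  (fun j jN => FMM x _ cx (grid_itv jN))
  (fun j jN => FMM y _ cy (grid_itv jN)) bl br.
have Fx0 : grid_slice x u 0 = F x by rewrite /grid_slice mul0r -xu upd_id.
have FyN : grid_slice y u N = F y by rewrite /grid_slice divff ?gt_eqF // -yu upd_id.
move: A0 B0 gain; rewrite Fx0 FyN => A0 B0 gain.
split=> // r r0.
apply: le_trans (gain r r0).
have r2 : 0 <= 2 * r by rewrite mulr_ge0.
rewrite ler_wpM2l //.
have := co u; set w := o 0 u => hw.
have <- : upd o u w = o by apply: upd_id.
rewrite upd_upd.
(* If o_u <= z, the loss is compared with the slice through [y], which lies above [o]; otherwise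
   with the slice through [x], below [o]. Rounding o_u to the grid costs 3 M / N on top of the 6 M /
   N of [balanced_gain]. *)
have [wz|zw] := lerP w z.
  have [v [vN gv _ /(_ i iN wz) vi]] := grid_rounding N3
    (nonincr_incr_upd u cy cy (vr y)) (fun z => FMM y z cy) hw.
  have := lossH v vi; rewrite /grid_slice -/z.
  have := nonincr_incr_upd u co cy oy (a := w) (b := w) (d := z - w).
  rewrite /= addrCA subrr addr0 subr_ge0 lexx wz.
  case/andP: hw => -> _; case/andP: hz => _ -> /(_ isT isT isT isT).
  lra.
have [v [vN gv /(_ i (ltW zw)) iv _]] := grid_rounding N3
  (nonincr_incr_upd u cx cx (vr x)) (fun z => FMM x z cx) hw.
have := lossG v; rewrite iv vN /grid_slice -/z => /(_ isT).
have := nonincr_incr_upd u cx co xo (a := z) (b := z) (d := w - z).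
rewrite /= addrCA subrr addr0 subr_ge0 lexx (ltW zw).
case/andP: hz => -> _; case/andP: hw => _ -> /(_ isT isT isT isT).
lra.
Qed.

(** The comparison vector, moving from [o] at stage 0 to the output at stage n. *)
Definition merge k x o : 'rV[R]_n := \row_j (if (j < k)%N then x 0 j else o 0 j).

(** The potential is quantified over all [o] and [r], which the run does not know. [greedy_F0] and
    [greedy_F1] serve the case F(o) <= F(x) at the end. *)
Record greedy_inv (k : nat) x y : Prop := {
  greedy_cubel : unit_cube x;
  greedy_cuber : unit_cube y;
  greedy_done : forall j : 'I_n, (j < k)%N -> x 0 j = y 0 j;
  greedy_todo : forall j : 'I_n, (k <= j)%N -> x 0 j = 0 /\ y 0 j = 1;
  greedy_F0 : F 0 <= F x;
  greedy_F1 : F (const_mx 1) <= F y;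
  greedy_potential : forall o (r : R), unit_cube o -> 0 <= r ->
    2 * r * (F o - F (merge k x o) - k%:R * (9 * M / N%:R)) <=
    F x - F 0 + r ^+ 2 * (F y - F (const_mx 1))
}.

Lemma greedy_inv_init : greedy_inv 0 0 (const_mx 1).
Proof.
split=> //.
- by move=> j; rewrite mxE lexx ler01.
- by move=> j; rewrite mxE lexx ler01.
- by move=> j; rewrite !mxE.
- move=> o r _ _; have -> : merge 0 0 o = o by apply/rowP => j; rewrite mxE.
  by rewrite mul0r !subrr !mulr0 addr0.
Qed.

Lemma greedy_inv_step k x y u i (z := i%:R / N%:R) :
  greedy_inv k x y -> val u = k -> (i <= N)%N ->
  ((0 < i)%N -> 0 <= balance N (grid_slice x u) (grid_slice y u) i.-1) ->
  ((i < N)%N -> balance N (grid_slice x u) (grid_slice y u) i <= 0) ->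
  greedy_inv k.+1 (upd x u z) (upd y u z).
Proof.
move=> [cx cy hd ht h0 h1 hp] uk iN bl br.
have hz : 0 <= z <= 1 by apply: grid_itv.
have [xu yu] : x 0 u = 0 /\ y 0 u = 1 by apply: ht; rewrite uk.
have xm o : unit_cube o -> vle x (merge k x o).
  move=> co j; rewrite mxE; case: ltnP => // /ht [-> _].
  by case/andP: (co j).
have my o : unit_cube o -> vle (merge k x o) y.
  move=> co j; rewrite mxE; case: ltnP => [/hd -> //|/ht [_ ->]].
  by case/andP: (co j).
have mE o : upd (merge k x o) u z = merge k.+1 (upd x u z) o.
  apply/rowP => j; rewrite !mxE -val_eqE /= uk ltnS.
  by case: (ltngtP j k).
have step o co := coordinate_step cx cy (xm o co) (my o co) xu yu iN bl br.
have c0 : unit_cube (0 : 'rV[R]_n) by move=> j; rewrite mxE lexx ler01.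
have [s1 s2 _] := step 0 c0.
split.
- exact: upd_cube.
- exact: upd_cube.
- move=> j; rewrite ltnS !updE -val_eqE /= uk => jk.
  by case: ltngtP jk => // jk _; apply: hd.
- move=> j kj; rewrite !updE -val_eqE /= uk gtn_eqF //.
  by apply: ht; apply: ltnW.
- exact: le_trans h0 s1.
- exact: le_trans h1 s2.
- move=> o r co r0; have [_ _ /(_ r r0)] := step o co.
  have := hp o r co r0; rewrite -/z mE -natr1.
  lra.
Qed.

Lemma greedy_inv_final x y (eps : R) :
  (forall B, (forall x, unit_cube x -> F x <= B) -> M <= B) ->
  18 * (n%:R / N%:R) <= eps -> eps <= 1 ->
  greedy_inv n x y ->
  forall o (r : R), unit_cube o -> 0 <= r ->
    (2 * r / (r + 1) ^+ 2 - 1 * eps) * F o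
    + 1 / (r + 1) ^+ 2 * F 0
    + r ^+ 2 / (r + 1) ^+ 2 * F (const_mx 1) <= F x.
Proof.
move=> Mlub nN e1 [cx cy hd ht h0 h1 hp].
have yx : y = x by apply/rowP => j; rewrite hd.
move: h1 hp; rewrite yx => h1 hp {y yx cy hd ht}.
have mE o : merge n x o = x by apply/rowP => j; rewrite mxE ltn_ord.
have c0 : unit_cube (0 : 'rV[R]_n) by move=> j; rewrite mxE lexx ler01.
have c1 : unit_cube (const_mx 1 : 'rV[R]_n) by move=> j; rewrite mxE lexx ler01.
have M0 : 0 <= M := le_trans (F0 c0) (FM c0).
set d := n%:R / N%:R in nN *.
have d0 : 0 <= d by rewrite divr_ge0.
have dE : n%:R * (9 * M / N%:R) = 9 * M * d by rewrite /d; ring.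
have dM : 18 * d * M <= M by rewrite ler_piMl //; lra.
have F00 := F0 c0; have F01 := F0 c1.
(* At r = 1 the potential gives F(o) <= 2 F(x) + 9 M d, and 18 d <= 1 makes the error at most M /
   2. *)
have M4 : M <= 4 * F x.
  suff : M <= 2 * F x + 2^-1 * M by lra.
  apply: Mlub => o co.
  have := hp o 1 co ler01; rewrite mE dE expr1n mulr1 mul1r; lra.
move=> o r co r0.
have r1 : 0 < (r + 1) ^+ 2 by rewrite exprn_gt0 //; lra.
have Fo := F0 co.
set D := (r + 1) ^+ 2 in r1 *.
rewrite -(ler_pM2r r1).
have -> : ((2 * r / D - 1 * eps) * F o + 1 / D * F 0
    + r ^+ 2 / D * F (const_mx 1)) * D =
    2 * r * F o + F 0 + r ^+ 2 * F (const_mx 1) - eps * F o * D.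
  by field; rewrite gt_eqF.
have eF : 0 <= (eps - 18 * d) * (F o * D).
  by rewrite mulr_ge0 ?subr_ge0 // mulr_ge0 // ltW.
have dF : 0 <= d * (F o * D) by rewrite mulr_ge0 // mulr_ge0 // ltW.
have DE : D = 2 * r + 1 + r ^+ 2 by rewrite /D; ring.
(* In the first case the three weights sum to 1 and none of F(o), F(0), F(1) exceeds F(x). *)
have [oV|Vo] := lerP (F o) (F x).
  have h2 : 2 * r * F o <= 2 * r * F x by rewrite ler_wpM2l // mulr_ge0.
  have h3 : r ^+ 2 * F (const_mx 1) <= r ^+ 2 * F x by rewrite ler_wpM2l // sqr_ge0.
  have -> : F x * D = 2 * r * F x + F x + r ^+ 2 * F x by rewrite DE; ring.
  lra.
have := hp o r co r0; rewrite mE dE.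
(* The accumulated error 2 r (9 M d) is absorbed by M <= 4 F(o) and 4 r <= (r + 1)^2. *)
have : 18 * r * d * M <= 18 * d * (F o * D).
  have h2 : M <= 4 * F o by lra.
  have h3 : 4 * r <= D by rewrite DE; have := sqr_ge0 (r - 1); lra.
  have h4 : r * M <= r * (4 * F o) by rewrite ler_wpM2l.
  have h5 : 4 * r * F o <= D * F o by rewrite ler_wpM2r.
  have -> : 18 * r * d * M = 18 * d * (r * M) by ring.
  rewrite ler_wpM2l ?mulr_ge0 //; lra.
have -> : F x * D = 2 * r * F x + F x + r ^+ 2 * F x by rewrite DE; ring.
lra.
Qed.

End DoubleGreedy.

(** * Total-correctness reasoning for programs *)

Section Runs.
Variables (R : realType) (n : nat) (F : 'rV[R]_n -> R).
Implicit Types (s : state R) (Q : state R -> nat -> nat -> Prop).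

(** A weakest precondition for total correctness whose postcondition also sees the time and the
    query count. *)
Definition runs c s Q := exists s' t q, exec F c s s' t q /\ Q s' t q.

Lemma runs_imply c s Q Q' : (forall s' t q, Q s' t q -> Q' s' t q) ->
  runs c s Q -> runs c s Q'.
Proof. by move=> QQ' [s' [t [q [e /QQ' h]]]]; exists s', t, q. Qed.

Lemma runs_skip s Q : Q s 1%N 0%N -> runs Skip s Q.
Proof. by move=> h; exists s, 1%N, 0%N; split=> //; constructor. Qed.

Lemma runs_nassign i e s Q :
  Q (set_nreg s i (neval s e)) 1%N 0%N -> runs (NAssign i e) s Q.
Proof. by move=> h; do 3 eexists; split; [constructor|exact: h]. Qed.

Lemma runs_rassign a e s Q :
  Q (set_cell s (neval s a) (reval s e)) 1%N 0%N -> runs (RAssign a e) s Q.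
Proof. by move=> h; do 3 eexists; split; [constructor|exact: h]. Qed.

Lemma runs_query d a s Q : unit_cube (read_vec n s (neval s a)) ->
  Q (set_cell s (neval s d) (F (read_vec n s (neval s a)))) 1%N 1%N ->
  runs (Query d a) s Q.
Proof. by move=> c h; do 3 eexists; split; [constructor|exact: h]. Qed.

Lemma runs_seq c1 c2 s Q :
  runs c1 s (fun s1 t1 q1 =>
    runs c2 s1 (fun s2 t2 q2 => Q s2 (t1 + t2)%N (q1 + q2)%N)) ->
  runs (Seq c1 c2) s Q.
Proof.
move=> [s1 [t1 [q1 [e1 [s2 [t2 [q2 [e2 h]]]]]]]].
by exists s2, (t1 + t2)%N, (q1 + q2)%N; split=> //; apply: exec_seq e1 e2.
Qed.

Lemma runs_if b c1 c2 s Q :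
  runs (if beval s b then c1 else c2) s (fun s' t q => Q s' t.+1 q) ->
  runs (If b c1 c2) s Q.
Proof.
move=> [s' [t [q [e h]]]]; exists s', t.+1, q; split=> //.
by case: ifP e => hb e; [apply: exec_if_true|apply: exec_if_false; rewrite ?hb].
Qed.

(** The index of [Inv] counts the remaining iterations, so it proves termination and bounds both
    costs. *)
Lemma runs_while (Inv : nat -> state R -> Prop) (T C : nat) b c k s :
  (forall j s, Inv j.+1 s -> beval s b /\
    runs c s (fun s' t q => [/\ Inv j s', (t <= T)%N & (q <= C)%N])) ->
  (forall s, Inv 0%N s -> ~~ beval s b) ->
  Inv k s ->
  runs (While b c) s (fun s' t q =>
    [/\ Inv 0%N s', (t <= k * T.+1 + 1)%N & (q <= k * C)%N]).
Proof.
move=> step stop; elim: k s => [|k IH] s inv.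
  by exists s, 1%N, 0%N; split; [apply: exec_while_false; apply: stop|].
have [hb [s1 [t1 [q1 [e1 [inv1 ht hq]]]]]] := step _ _ inv.
have [s2 [t2 [q2 [e2 [inv2 ht2 hq2]]]]] := IH _ inv1.
exists s2, (t1 + t2).+1, (q1 + q2)%N; split; first exact: exec_while_true e1 e2.
by split=> //; rewrite mulSn; lia.
Qed.

End Runs.

(** * Reading the stored vectors after writes *)

Section Memory.
Variables (R : realType) (n : nat).
Implicit Types (s : state R).

Lemma cell_set s a v b : cell (set_cell s a v) b = if b == a then v else cell s b.
Proof. by []. Qed.

Lemma read_set_out s a v b : (forall j : 'I_n, (b + j)%N <> a) ->
  read_vec n (set_cell s a v) b = read_vec n s b.
Proof. by move=> h; apply/rowP => j; rewrite !mxE cell_set; case: eqP => // /h. Qed.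

Lemma read_set_in s v b (u : 'I_n) :
  read_vec n (set_cell s (b + u) v) b = upd (read_vec n s b) u v.
Proof. by apply/rowP => j; rewrite !mxE cell_set eqn_add2l. Qed.

Lemma read_lower s v (u : 'I_n) :
  read_vec n (set_cell (set_cell s u v) (n + u) v) 0 = upd (read_vec n s 0) u v.
Proof.
have un := ltn_ord u.
rewrite read_set_out; first by rewrite -[X in set_cell s X]add0n read_set_in.
by move=> j; have := ltn_ord j; lia.
Qed.

Lemma read_upper s v (u : 'I_n) :
  read_vec n (set_cell (set_cell s u v) (n + u) v) n = upd (read_vec n s n) u v.
Proof.
have un := ltn_ord u.
rewrite read_set_in read_set_out // => j; have := ltn_ord j; lia.
Qed.

Lemma read_scratch s d v b : (0 < d)%N -> (b <= n)%N ->
  read_vec n (set_cell s (n + n + d) v) b = read_vec n s b.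
Proof. by move=> d0 bn; rewrite read_set_out // => j; have := ltn_ord j; lia. Qed.

End Memory.

(* Memory layout: cells [0, n) hold the lower vector, cells [n, 2n) the upper
   one, and [scratch 1], ..., [scratch 8] respectively hold eps, the number
   N + 1 = 2 ^ m of grid points, the lower end and half the length of the search
   interval, and four oracle answers. Register 1 is the current coordinate. *)
Definition scratch (k : nat) : nexp := NAdd (NAdd (NReg 0) (NReg 0)) (NConst k).
Definition tmp (k : nat) : rexp := RCell (scratch k).
Definition rnat (k : nat) : rexp := RNat (NConst k).

(** Doubling replaces a logarithm. The threshold 36 n / eps for N + 1, twice the required 18 n /
    eps, pays for the difference between N + 1 and N. *)
Definition grow_grid : cmd :=
  While (BRle (RMul (tmp 2) (tmp 1)) (RMul (rnat 36) (RNat (NReg 0))))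
    (RAssign (scratch 2) (RAdd (tmp 2) (tmp 2))).

Definition next_coordinate : cmd := NAssign 1 (NAdd (NReg 1) (NConst 1)).

Definition for_coordinates (c : cmd) : cmd :=
  While (BNle (NAdd (NReg 1) (NConst 1)) (NReg 0)) (Seq c next_coordinate).

Definition fill_ones : cmd :=
  for_coordinates (RAssign (NAdd (NReg 0) (NReg 1)) (rnat 1)).

Definition set_coordinate (e : rexp) : cmd :=
  let z := RDiv e (RSub (tmp 2) (rnat 1)) in
  Seq (RAssign (NReg 1) z) (RAssign (NAdd (NReg 0) (NReg 1)) z).

(** Query points are formed in place, so during a search the current coordinate of both vectors is
    arbitrary; [search_inv] therefore compares vectors only after [upd]. *)
Definition probe (e : rexp) (d1 d2 : nat) : cmd :=
  Seq (set_coordinate e)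
    (Seq (Query (scratch d1) (NConst 0)) (Query (scratch d2) (NReg 0))).

Definition candidate : rexp := RAdd (tmp 3) (tmp 4).

(** This is [balance] on the cell ending at the candidate c, with weights N - c and c - 1. *)
Definition balance_exp : rexp :=
  RAdd (RMul (RSub (tmp 5) (tmp 7)) (RSub (RSub (tmp 2) (rnat 1)) candidate))
       (RMul (RSub (tmp 6) (tmp 8)) (RSub candidate (rnat 1))).

Definition search_step : cmd :=
  Seq (probe candidate 5 6)
    (Seq (probe (RSub candidate (rnat 1)) 7 8)
      (Seq (If (BRle balance_exp (rnat 0)) Skip (RAssign (scratch 3) candidate))
        (RAssign (scratch 4) (RDiv (tmp 4) (rnat 2))))).

(** Half the length is a real number: it is 1/2 exactly when a single grid point is left, which
    stops the loop. *)
Definition search : cmd := While (BRle (rnat 1) (tmp 4)) search_step.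

Definition process_coordinate : cmd :=
  Seq (RAssign (scratch 3) (rnat 0))
    (Seq (RAssign (scratch 4) (RDiv (tmp 2) (rnat 2)))
      (Seq search (set_coordinate (tmp 3)))).

(** Cell 0 is both the input eps and the first entry of the lower vector, so eps is saved before
    that cell is cleared; the other entries start at 0. *)
Definition double_greedy : cmd :=
  Seq (RAssign (scratch 1) (RCell (NConst 0)))
    (Seq (RAssign (scratch 2) (rnat 1))
      (Seq grow_grid
        (Seq (RAssign (NConst 0) (rnat 0))
          (Seq fill_ones
            (Seq (NAssign 1 (NConst 0)) (for_coordinates process_coordinate)))))).

Ltac decide_addresses :=
  repeat (case: eqP => ?; try by [exfalso; lia]).

(** * Correctness of the search and of one coordinate *)

Section Correctness.
Variables (R : realType) (n : nat) (F : 'rV[R]_n -> R).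
Implicit Types (s : state R) (Q : state R -> nat -> nat -> Prop) (x y : 'rV[R]_n).

(** [e] is evaluated twice, the second time after the first write, hence the hypothesis that this
    write preserves its value. *)
Lemma runs_set_coordinate e s (u : 'I_n) Q
  (z := reval s e / (cell s (n + n + 2) - 1)) :
  nreg s 0 = n -> nreg s 1 = u ->
  reval (set_cell s u z) e = reval s e ->
  Q (set_cell (set_cell s u z) (n + u) z) 2%N 0%N ->
  runs F (set_coordinate e) s Q.
Proof.
move=> n0 n1 he h; have un := ltn_ord u.
apply: runs_seq; apply: runs_rassign; rewrite /= n1 n0 -/z.
apply: runs_rassign; rewrite /= n1 n0 he; move: h.
by decide_addresses.
Qed.

Lemma runs_probe e d1 d2 s (u : 'I_n) x y z Q :
  nreg s 0 = n -> nreg s 1 = u ->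
  z = reval s e / (cell s (n + n + 2) - 1) ->
  reval (set_cell s u z) e = reval s e ->
  upd (read_vec n s 0) u z = x -> upd (read_vec n s n) u z = y ->
  unit_cube x -> unit_cube y -> (0 < d1)%N ->
  Q (set_cell (set_cell (set_cell (set_cell s u z) (n + u) z)
       (n + n + d1) (F x)) (n + n + d2) (F y)) 4%N 2%N ->
  runs F (probe e d1 d2) s Q.
Proof.
move=> n0 n1 -> he hx hy cx cy d1p h; have un := ltn_ord u.
apply: runs_seq; apply: (@runs_set_coordinate _ _ u) => //.
have un' : (u < n)%N by [].
apply: runs_seq; apply: runs_query; rewrite /= read_lower hx //.
apply: runs_query; rewrite /= n0 ?read_scratch // read_upper hy //.
Qed.

(* [N.+1 = 2 ^ m] makes the N.+1 candidate grid points a dyadic search space. *)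
Record search_inv (N : nat) x y (u : 'I_n) (k i : nat) s : Prop := {
  search_n : nreg s 0 = n;
  search_u : nreg s 1 = u;
  search_N : cell s (n + n + 2) = N.+1%:R;
  search_lo : cell s (n + n + 3) = i%:R;
  search_half : cell s (n + n + 4) = (2 ^ k)%:R / 2;
  search_x : forall z, upd (read_vec n s 0) u z = upd x u z;
  search_y : forall z, upd (read_vec n s n) u z = upd y u z;
  search_in : (i + 2 ^ k <= N.+1)%N;
  search_l : (0 < i)%N ->
    0 <= balance N (grid_slice F N x u) (grid_slice F N y u) i.-1;
  search_r : (i + 2 ^ k <= N)%N ->
    balance N (grid_slice F N x u) (grid_slice F N y u) (i + 2 ^ k).-1 <= 0
}.

Lemma search_step_correct N x y (u : 'I_n) k i s : (3 <= N)%N ->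
  unit_cube x -> unit_cube y -> search_inv N x y u k.+1 i s ->
  runs F search_step s (fun s' t q =>
    [/\ exists i', search_inv N x y u k i' s', (t <= 11)%N & (q <= 4)%N]).
Proof.
move=> N3 cx cy [n0 n1 cN clo chalf hx hy hin hl hr].
have un := ltn_ord u.
pose c := (i + 2 ^ k)%N.
have c1 : (0 < c)%N by rewrite addn_gt0 expn_gt0 orbT.
have cN1 : (c < N.+1)%N.
  by apply: leq_trans hin; rewrite expnS mul2n -addnn addnA -addn1 leq_add2l expn_gt0.
have halfE : (2 ^ k.+1)%:R / 2 = (2 ^ k)%:R :> R.
  by rewrite expnS natrM mulrAC divff ?mul1r // pnatr_eq0.
have cE : i%:R + (2 ^ k)%:R = c%:R :> R by rewrite -natrD.
have NE : N.+1%:R - 1 = N%:R :> R by rewrite -natr1 addrK.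
have cE1 : c%:R - 1 = c.-1%:R :> R by rewrite -{1}(prednK c1) -natr1 addrK.
have cube_at v j : unit_cube v -> (j <= N)%N -> unit_cube (upd v u (j%:R / N%:R : R)).
  by move=> cv jN; apply: upd_cube => //; apply: grid_itv.
apply: runs_seq.
apply: (@runs_probe _ _ _ _ u (upd x u (c%:R / N%:R)) (upd y u (c%:R / N%:R))
  (c%:R / N%:R)) => //.
- by rewrite /= n0 clo chalf halfE cE cN NE.
- by rewrite /= n0; decide_addresses.
- by apply: cube_at.
- by apply: cube_at.
apply: runs_seq.
apply: (@runs_probe _ _ _ _ u (upd x u (c.-1%:R / N%:R))
  (upd y u (c.-1%:R / N%:R)) (c.-1%:R / N%:R)) => //.
- rewrite /= n0; decide_addresses.
  by rewrite clo chalf halfE cE cN NE cE1.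
- by rewrite /= n0; decide_addresses.
- by rewrite !read_scratch ?read_lower ?upd_upd.
- by rewrite !read_scratch ?read_upper ?upd_upd.
- by apply: cube_at => //; lia.
- by apply: cube_at => //; lia.
apply: runs_seq; apply: runs_if.
(* Forget the state left by the two probes, keeping only what the rest of the step reads. *)
match goal with |- runs _ _ ?S _ =>
  have : [/\ [/\ nreg S 0 = n, nreg S 1 = u, cell S (n + n + 2) = N.+1%:R,
      cell S (n + n + 3) = i%:R & cell S (n + n + 4) = (2 ^ k.+1)%:R / 2],
    forall z, upd (read_vec n S 0) u z = upd x u z,
    forall z, upd (read_vec n S n) u z = upd y u z &
    beval S (BRle balance_exp (rnat 0)) =
      (balance N (grid_slice F N x u) (grid_slice F N y u) c.-1 <= 0)];
  last move: (S) => s1 [[m0 m1 mN mlo mhalf] mx my ->]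
end.
  split; last 1 first.
  - rewrite /= n0; decide_addresses.
    rewrite clo chalf halfE cE cN NE cE1 /balance /grid_slice prednK //.
    by rewrite natrB.
  - by split=> //=; decide_addresses.
  - by move=> z; rewrite !(read_scratch, read_lower) // !upd_upd.
  - by move=> z; rewrite !(read_scratch, read_upper) // !upd_upd.
(* The sign at the cell ending at [c] becomes the right-end condition of the lower half or the
   left-end condition of the upper half. *)
case: ifP => bal; [apply: runs_skip|apply: runs_rassign].
  apply: runs_rassign; split=> //; exists i; rewrite /= m0 mhalf halfE; split=> //=.
  - by decide_addresses.
  - by decide_addresses.
  - by decide_addresses.
  - by move=> z; rewrite read_scratch.
  - by move=> z; rewrite read_scratch.
  - exact: ltnW.
apply: runs_rassign; split=> //; exists c; rewrite /= m0 mlo mhalf halfE cE.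
have ck : (c + 2 ^ k = i + 2 ^ k.+1)%N by rewrite expnS mul2n -addnn addnA.
split=> //=.
- by decide_addresses.
- by decide_addresses.
- by decide_addresses.
- by move=> z; rewrite !read_scratch.
- by move=> z; rewrite !read_scratch.
- by rewrite ck.
- by move=> _; rewrite leNgt; apply/negP => /ltW; rewrite bal.
- by rewrite ck.
Qed.

Lemma search_correct N m x y (u : 'I_n) s : (3 <= N)%N -> (N.+1 = 2 ^ m)%N ->
  unit_cube x -> unit_cube y -> search_inv N x y u m 0 s ->
  runs F search s (fun s' t q =>
    [/\ exists i, search_inv N x y u 0 i s', (t <= 12 * m + 1)%N & (q <= 4 * m)%N]).
Proof.
move=> N3 Nm cx cy inv.
apply: runs_imply (@runs_while _ _ F
  (fun k s => exists i, search_inv N x y u k i s) 11 4 _ _ m s _ _ _).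
- by move=> s' t q [inv' ht hq]; split=> //; rewrite mulnC.
- move=> k {inv}s [i inv]; split.
    rewrite /= (search_n inv) (search_half inv) expnS natrM mulrAC divff ?pnatr_eq0 //.
    by rewrite mul1r ler1n expn_gt0.
  exact: search_step_correct inv.
- move=> {inv}s [i inv]; rewrite /= (search_n inv) (search_half inv) -ltNge.
  lra.
- by exists 0%N.
Qed.

Record memory (N k : nat) x y s : Prop := {
  memory_n : nreg s 0 = n;
  memory_k : nreg s 1 = k;
  memory_N : cell s (n + n + 2) = N.+1%:R;
  memory_x : read_vec n s 0 = x;
  memory_y : read_vec n s n = y
}.

Hypothesis F0 : forall x, unit_cube x -> 0 <= F x.
Hypothesis FDR : dr_submodular F.

Lemma process_coordinate_correct N m M k x y s :
  (3 <= N)%N -> (N.+1 = 2 ^ m)%N -> (forall x, unit_cube x -> F x <= M) ->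
  (k < n)%N -> memory N k x y s -> greedy_inv F N M k x y ->
  runs F process_coordinate s (fun s' t q =>
    [/\ exists x' y', memory N k x' y' s' /\ greedy_inv F N M k.+1 x' y',
        (t <= 12 * m + 5)%N & (q <= 4 * m)%N]).
Proof.
move=> N3 Nm FM kn [n0 n1 cN hx hy] inv.
pose u := Ordinal kn.
apply: runs_seq; apply: runs_rassign; apply: runs_seq; apply: runs_rassign.
apply: runs_seq.
have inv0 : search_inv N x y u m 0
    (set_cell (set_cell s (n + n + 3) 0) (n + n + 4) (N.+1%:R / 2)).
  split=> //=; rewrite ?add0n.
  - by decide_addresses.
  - by decide_addresses.
  - by decide_addresses; rewrite Nm.
  - by move=> z; rewrite !read_scratch // hx.
  - by move=> z; rewrite !read_scratch // hy.
  - by rewrite Nm.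
  - by rewrite -Nm ltnn.
rewrite /= n0; case: eqP => [?|_]; first by exfalso; lia.
rewrite cN.
apply: runs_imply (search_correct N3 Nm (greedy_cubel inv) (greedy_cuber inv) inv0).
move=> {n0 n1 cN hx hy inv0}s t q [[i [n0 n1 cN clo chalf hx hy hin hl hr]] ht hq].
have iN : (i <= N)%N by move: hin; rewrite expn0; lia.
have NE : N.+1%:R - 1 = N%:R :> R by rewrite -natr1 addrK.
apply: (@runs_set_coordinate _ _ u) => /=; rewrite ?n0; decide_addresses => //.
rewrite clo cN NE; split; last 2 first.
- by lia.
- by lia.
exists (upd x u (i%:R / N%:R)), (upd y u (i%:R / N%:R)); split.
  split=> //=.
  - by decide_addresses.
  - by rewrite (read_lower _ _ u) hx.
  - by rewrite (read_upper _ _ u) hy.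
(* With one point left, the two end conditions of the search are the sign conditions on the cells
   around [i]. *)
apply: greedy_inv_step => // iN'.
by have := hr; rewrite expn0 addn1 /=; apply.
Qed.

End Correctness.

(** * Correctness and cost of the whole program *)

Section Program.
Variables (R : realType) (n : nat) (F : 'rV[R]_n -> R).
Implicit Types (s : state R) (x y : 'rV[R]_n).

Lemma runs_for_coordinates (Inv : nat -> state R -> Prop) (T C : nat) c s :
  (forall k s, Inv k s -> nreg s 0 = n /\ nreg s 1 = k) ->
  (forall k s, (k < n)%N -> Inv k s -> runs F c s (fun s' t q =>
     [/\ nreg s' 1 = k, Inv k.+1 (set_nreg s' 1 k.+1), (t <= T)%N & (q <= C)%N])) ->
  Inv 0 s ->
  runs F (for_coordinates c) s (fun s' t q =>
    [/\ Inv n s', (t <= n * T.+2 + 1)%N & (q <= n * C)%N]).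
Proof.
move=> regs body inv.
apply: runs_imply (@runs_while _ _ F
  (fun j s => exists k, (k + j)%N = n /\ Inv k s) T.+1 C _ _ n s _ _ _).
- by move=> s' t q [[k [<- inv']] ht hq]; rewrite addn0 in ht hq inv' *.
- move=> j {inv}s [k [kj inv]]; have [r0 r1] := regs _ _ inv.
  have kn : (k < n)%N by lia.
  split; first by rewrite /= r0 r1 addn1.
  apply: runs_seq; apply: runs_imply (body k s kn inv) => s' t q [r1' inv' ht hq].
  apply: runs_nassign; rewrite /= r1' addn1; split; [|lia|lia].
  by exists k.+1; split=> //; lia.
- move=> {inv}s [k [kj inv]]; have [r0 r1] := regs _ _ inv.
  by rewrite /= r0 r1; lia.
- by exists 0%N.
Qed.

Lemma grow_grid_correct m (eps : R) s :
  nreg s 0 = n -> cell s (n + n + 1) = eps -> cell s (n + n + 2) = 1 ->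
  (forall k, (k < m)%N -> (2 ^ k)%:R * eps <= 36 * n%:R) ->
  36 * n%:R < (2 ^ m)%:R * eps ->
  runs F grow_grid s (fun s' t q =>
    [/\ [/\ nreg s' 0 = n, nreg s' 1 = nreg s 1, cell s' (n + n + 2) = (2 ^ m)%:R &
         forall a, (a < n + n)%N -> cell s' a = cell s a],
        (t <= m * 2 + 1)%N & (q <= 0)%N]).
Proof.
move=> n0 ceps c2 small large.
pose Inv j s' := exists i, [/\ (i + j)%N = m, nreg s' 0 = n /\ nreg s' 1 = nreg s 1,
  cell s' (n + n + 1) = eps, cell s' (n + n + 2) = (2 ^ i)%:R &
  forall a, (a < n + n)%N -> cell s' a = cell s a].
apply: runs_imply (@runs_while _ _ F Inv 1 0 _ _ m s _ _ _).
- move=> s' t q [[i [im [r0 r1] _ r2 low]] ht hq].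
  by rewrite muln0 in hq; rewrite addn0 in im; subst i.
- move=> j s' [i [ij [r0 rr] r1 r2 low]]; split.
    by rewrite /= r0 r1 r2; apply: small; lia.
  apply: runs_rassign; split=> //; exists i.+1; rewrite /= r0 r2; split=> //=.
  + by lia.
  + by decide_addresses.
  + by decide_addresses; rewrite -natrD addnn -mul2n expnS.
  + by move=> a an; decide_addresses; apply: low.
- move=> s' [i [ij [r0 rr] r1 r2 low]]; rewrite addn0 in ij.
  by rewrite /= r0 r1 r2 ij -ltNge.
- by exists 0%N.
Qed.

Hypothesis F0 : forall x, unit_cube x -> 0 <= F x.
Hypothesis FDR : dr_submodular F.

(** For [n = 0] the hypotheses force [m = 0] and [N = 0], hence the guard on [3 <= N]. *)
Lemma double_greedy_correct m N (eps M : R) :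
  (forall k, (k < m)%N -> (2 ^ k)%:R * eps <= 36 * n%:R) ->
  36 * n%:R < (2 ^ m)%:R * eps ->
  (N.+1 = 2 ^ m)%N -> ((0 < n)%N -> (3 <= N)%N) ->
  (forall x, unit_cube x -> F x <= M) ->
  runs F double_greedy (init_state n eps) (fun s t q =>
    [/\ exists y, greedy_inv F N M n (output n s) y,
        (t <= 20 * (m + 1) * (n + 1))%N & (q <= n * (4 * m))%N]).
Proof.
move=> small large Nm N3 FM.
apply: runs_seq; apply: runs_rassign; apply: runs_seq; apply: runs_rassign.
apply: runs_seq.
set s0 := set_cell _ _ _.
have low0 a : (0 < a < n + n)%N -> cell s0 a = 0.
  by move=> ha; rewrite /s0 /=; decide_addresses.
have s00 : nreg s0 0 = n by [].
have s01 : cell s0 (n + n + 1) = eps by rewrite /s0 /=; decide_addresses.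
have s02 : cell s0 (n + n + 2) = 1 by rewrite /s0 /=; decide_addresses.
apply: runs_imply (grow_grid_correct s00 s01 s02 small large).
move=> s t1 q1 [[r0 r1 r2 low] ht1 hq1].
have {}r1 : nreg s 1 = 0%N by [].
clearbody s0.
apply: runs_seq; apply: runs_rassign; apply: runs_seq.
pose Ones k s' := [/\ nreg s' 0 = n, nreg s' 1 = k, cell s' (n + n + 2) = N.+1%:R,
  read_vec n s' 0 = 0 & forall j, (j < k)%N -> cell s' (n + j) = 1].
apply: runs_imply (@runs_for_coordinates Ones 1 0 _ _ _ _ _).
- move=> {r0 r1 r2 low}s t2 q2 [[r0 r1 r2 x0 y1] ht2 hq2].
  apply: runs_seq; apply: runs_nassign => /=.
  pose Inv k s' := exists x y, memory N k x y s' /\ greedy_inv F N M k x y.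
  apply: runs_imply (@runs_for_coordinates Inv (12 * m + 5) (4 * m) _ _ _ _ _).
  + move=> s' t3 q3 [[x [y [mem inv]]] ht3 hq3]; split.
    * by exists y; rewrite /output (memory_x mem).
    * have : (n * (12 * m + 5).+2 <= n * (12 * m + 7))%N by lia.
      nia.
    * by lia.
  + by move=> k s' [x [y [[]]]].
  + move=> k s' kn [x [y [mem inv]]].
    apply: runs_imply (process_coordinate_correct F0 FDR (N3 _) Nm FM kn mem inv).
      move=> s1 t q [[x' [y' [[a1 a2 a3 a4 a5] inv']]] ht hq].
      by split=> //; exists x', y'.
    exact: leq_ltn_trans kn.
  + exists 0, (const_mx 1); split; last exact: greedy_inv_init.
    split=> //; apply/rowP => j; rewrite !mxE; exact: y1.
- by move=> k s' [].
- move=> k s' kn [a0 a1 a2 a3 a4]; apply: runs_rassign; rewrite /= a0 a1.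
  split=> //; split=> //=.
  + by decide_addresses.
  + by rewrite -[RHS]a3; apply: read_set_out => j; have := ltn_ord j; lia.
  + move=> j jk; case: eqP => // jk'; apply: a4; lia.
- split=> //=.
  + by decide_addresses; rewrite r2 Nm.
  + apply/rowP => j; rewrite !mxE cell_set; case: eqP => //= j0.
    by have un := ltn_ord j; rewrite low ?low0 //; lia.
Qed.

End Program.

(** * Size of the grid and the final bounds *)

Lemma grid_size_exists (R : realType) (n : nat) (eps : R) : 0 < eps ->
  exists m, (forall k, (k < m)%N -> (2 ^ k)%:R * eps <= 36 * n%:R) /\
    36 * n%:R < (2 ^ m)%:R * eps.
Proof.
move=> e0.
have ex : exists m, 36 * n%:R < (2 ^ m)%:R * eps.
  exists (Num.truncn (36 * n%:R / eps)).+1.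
  rewrite -ltr_pdivrMr //; apply: lt_trans (truncnS_gt _) _.
  by rewrite ltr_nat ltn_expl.
have [m h hmin] := ex_minnP ex; exists m; split=> // k km.
by rewrite leNgt; apply/negP => /hmin; rewrite leqNgt km.
Qed.

(** The test still succeeded at m - 1, so 2^m <= 72 n / eps with 72 = 2 * 36. *)
Lemma grid_size_log (R : realType) (n m : nat) (eps : R) :
  (0 < n)%N -> 0 < eps < 1 ->
  (forall k, (k < m)%N -> (2 ^ k)%:R * eps <= 36 * n%:R) ->
  m%:R <= (ln 72 + ln (n%:R * eps^-1)) / ln 2 :> R.
Proof.
move=> n0 /andP[e0 e1] small.
have nR : 1 <= n%:R :> R by rewrite ler1n.
have l2 : 0 < ln 2 :> R by rewrite ln_gt0 // ltr1n.
have ne : 1 <= n%:R * eps^-1 :> R.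
  rewrite ler_pdivlMr // mul1r; lra.
rewrite ler_pdivlMr // -lnM ?posrE //; last by lra.
rewrite [m%:R * _]mulr_natl -lnXn ?ltr0n // ler_ln ?posrE ?exprn_gt0 ?ltr0n //; last by lra.
case: m small => [|m] small; first by rewrite expr0; lra.
have := small m (ltnSn _); rewrite -ler_pdivlMr // natrX exprS; lra.
Qed.

Theorem theorem2p5 (R : realType) :
  exists (p : cmd) (k : nat) (Ctime Cquery Cerr : R),
    forall (n : nat) (F : 'rV[R]_n -> R) (eps : R),
      (forall x : 'rV[R]_n, unit_cube x -> 0 <= F x) ->
      dr_submodular F ->
      0 < eps < 1 ->
      exists (s : state R) (t q : nat),
        [/\ exec F p (init_state n eps) s t q,
            t%:R <= Ctime * (1 + n%:R + ln (eps^-1)) ^+ k,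
            q%:R <= Cquery * (n%:R * Num.max 1 (ln (n%:R * eps^-1))),
            unit_cube (output n s) &
            forall (o : 'rV[R]_n) (r : R), unit_cube o -> 0 <= r ->
              (2 * r / (r + 1) ^+ 2 - Cerr * eps) * F o
              + 1 / (r + 1) ^+ 2 * F 0
              + r ^+ 2 / (r + 1) ^+ 2 * F (const_mx 1)
              <= F (output n s)].
Proof.
have l2 : 0 < ln 2 :> R by rewrite ln_gt0 // ltr1n.
have l72 : 0 < ln 72 :> R by rewrite ln_gt0 // ltr1n.
(* Chosen so that m <= C max(1, ln(n / eps)): the term ln 72 is absorbed by the maximum being at
   least 1. *)
pose C : R := (ln 72 + 1) / ln 2.
have C0 : 0 <= C by rewrite divr_ge0 //; lra.
exists double_greedy, 2%N, (20 * (C + 1)), (4 * C), 1 => n F eps F0 FDR e01.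
have /andP[e0 e1] := e01.
have [m [small large]] := grid_size_exists n e0.
have le0 : 0 <= ln eps^-1 by rewrite ln_ge0 // invf_ge1 // ltW.
have [M [FM Mlub]] := cube_sup F0 FDR.
have p2 : (0 < 2 ^ m)%N by rewrite expn_gt0.
have Nm : ((2 ^ m).-1.+1 = 2 ^ m)%N by rewrite prednK.
set N := (2 ^ m).-1 in Nm.
have N36 : (0 < n)%N -> (36 <= N)%N.
  move=> n0; rewrite -ltnS Nm -(ltr_nat R).
  apply: le_lt_trans (_ : 36 * n%:R < _); first by rewrite ler_peMr // ler1n.
  by apply: lt_le_trans large _; rewrite ler_piMr // ltW.
have m_log : (0 < n)%N -> m%:R <= (ln 72 + ln (n%:R * eps^-1)) / ln 2.
  by move=> n0; apply: grid_size_log.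
have [s [t [q [ex [[y inv] ht hq]]]]] := double_greedy_correct F0 FDR small large
  Nm (fun n0 => leq_trans (isT : 2 < 36)%N (N36 n0)) FM.
exists s, t, q; split=> //.
- set D := 1 + n%:R + ln eps^-1.
  have nR : 0 <= n%:R :> R by [].
  have D1 : 1 <= D by rewrite /D; lra.
  have nD : n%:R + 1 <= D by rewrite /D; lra.
  have mD : m%:R + 1 <= (C + 1) * D.
    case: (posnP n) => [n0|n0].
      have -> : m = 0%N.
        case: (m) small => // m' /(_ 0%N isT); rewrite n0 expn0 => ?; exfalso; lra.
      by rewrite add0r -[leLHS]mul1r; apply: ler_pM => //; lra.
    suff : m%:R <= C * D by lra.
    apply: le_trans (m_log n0) _; rewrite /C mulrAC ler_pM2r ?invr_gt0 //.
    have n1 : 0 < n%:R :> R by rewrite ltr0n.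
    rewrite lnM ?posrE ?invr_gt0 //.
    have : ln n%:R <= n%:R :> R by rewrite ltW // ln_sublinear.
    have : 0 <= ln 72 * (D - 1) by rewrite mulr_ge0 // ?ltW //; lra.
    rewrite /D; lra.
  apply: le_trans (_ : (20 * (m + 1) * (n + 1))%:R <= _); first by rewrite ler_nat.
  rewrite !natrM !natrD -!mulrA ler_wpM2l // expr2 mulrA.
  by apply: ler_pM => //; rewrite ?addr_ge0.
- case: (posnP n) => [n0|n0].
    by move: hq; rewrite n0 mul0n leqn0 => /eqP ->; rewrite mul0r mulr0.
  apply: le_trans (_ : (n * (4 * m))%:R <= _); first by rewrite ler_nat.
  rewrite !natrM mulrCA -mulrA ler_wpM2l // mulrCA ler_wpM2l //.
  apply: le_trans (m_log n0) _; rewrite /C mulrAC ler_pM2r ?invr_gt0 //.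
  set X := Num.max _ _.
  have X1 : 1 <= X by rewrite le_max lexx.
  have lX : ln (n%:R * eps^-1) <= X by rewrite le_max lexx orbT.
  have : 0 <= ln 72 * (X - 1) by rewrite mulr_ge0 ?subr_ge0 // ltW.
  lra.
- exact: greedy_cubel inv.
- apply: (greedy_inv_final F0 FM Mlub _ (ltW e1) inv).
  (* For n > 0, 36 n < (N + 1) eps <= 2 N eps. *)
  case: (posnP n) => [->|n0]; first by rewrite mul0r mulr0 ltW.
  have NR : 36 <= N%:R :> R by rewrite (ler_nat R 36); exact: N36.
  rewrite mulrA ler_pdivrMr; last by lra.
  move: large; rewrite -Nm -natr1.
  have : 0 <= eps * (N%:R - 1) by rewrite mulr_ge0 ?ltW // subr_gt0; lra.
  lra.
Qed.
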